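(* Consider a system with $N>3$ agents and the rounded quantized VCG mechanism (defined in the context) with a given $\epsilon$ satisfying $0<\epsilon\le\frac\beta2$ and monetary unit $\delta=\frac\epsilon M$. Suppose all agents use the same one of the three strategies FLOOR, CEILING, CEILOOR (the last one only when $M$ is even). Then the worst-case efficiency is no less than $$\frac{M\beta+2(\alpha-\beta)-M\epsilon}{M\alpha+2(\alpha-\beta)-[M-N+1]^+(\alpha-\beta)};$$ that is, for all admissible utility functions $u_1,\dots,u_N$, the resulting allocation $\tilde{\mathbf y}^*$ satisfies $$\frac{\sum_{n=1}^N u_n(\frac{\tilde y_n^*}M)}{\max_{\mathbf x\in P_f}\sum_{n=1}^N u_n(x_n)}\ \ge\ \frac{M\beta+2(\alpha-\beta)-M\epsilon}{M\alpha+2(\alpha-\beta)-[M-N+1]^+(\alpha-\beta)}.$$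
   Context: Setting: $\mathcal N=\{1,\dots,N\}$ is the set of agents. $f:2^{\mathcal N}\to\mathbb R$ is normalized ($f(\emptyset)=0$), monotone, submodular, with $f(\mathcal N)=1$ and strictly positive minimum distance $\triangle f=\min_{S\subseteq\mathcal N}\min_{i\ne j\in\mathcal N\setminus S}|f(S\cup\{i\})+f(S\cup\{j\})-f(S)-f(S\cup\{i,j\})|$; $P_f=\{\mathbf x\in\mathbb R_+^N:\sum_{n\in S}x_n\le f(S)\ \forall S\subseteq\mathcal N\}$. $M$ is an integer with $M\ge 2/\triangle f$, $\tilde f(S)=\lfloor f(S)M\rfloor$, and $P_{\tilde f}=\{\mathbf y\in\mathbb N^N:\sum_{n\in S}y_n\le\tilde f(S)\ \forall S\subseteq\mathcal N\}$, which is an integral polymatroid. $[z]^+=\max\{z,0\}$. Admissible utilities: each $u_n$ on $[0,1]$ is nonnegative, concave and strictly increasing with $\beta<u_n'<\alpha$, where $\alpha,\beta>0$ are publicly known constants. The true surrogate marginal utilities are $\hat v_{nm}=u_n(\frac mM)-u_n(\frac{m-1}M)-\frac\beta M$, $1\le m\le\tilde f(\{n\})$. Rounded quantized VCG mechanism with monetary unit $\delta>0$: each agent $n$ submits a non-increasing vector of nonnegative integers $\hat W_n=(\hat w_{n1},\dots,\hat w_{n\tilde f(\{n\})})$, and the mechanism selects $\tilde{\mathbf y}^*\in P_{\tilde f}$ maximizing $\sum_{n=1}^N\tilde u_n(\frac{y_n}M)$ over $\mathbf y\in P_{\tilde f}$, where $\tilde u_n(\frac{y_n}M)=\sum_{m=1}^{y_n}\hat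 w_{nm}\delta+\beta\frac{y_n}M$, ties being broken arbitrarily; agent $n$ receives $\tilde y_n^*/M$ (and makes a VCG payment, which does not affect social welfare). Strategies: FLOOR: $\hat w_{nm}=\lfloor\hat v_{nm}/\delta\rfloor$ for all $m$. CEILING: $\hat w_{nm}=\lceil\hat v_{nm}/\delta\rceil$ for all $m$. CEILOOR ($M$ even): $\hat w_{nm}=\lceil\hat v_{nm}/\delta\rceil$ for $m\le M/2$ and $\hat w_{nm}=\lfloor\hat v_{nm}/\delta\rfloor$ for $m>M/2$. *)

(* Defs.v *)
From HB Require Import structures.
From mathcomp Require Import all_boot all_order all_algebra.
From mathcomp Require Import all_classical all_reals all_analysis.
From mathcomp Require Import ring lra.

Set Implicit Arguments.
Unset Strict Implicit.
Unset Printing Implicit Defensive.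

Import Order.TTheory GRing.Theory Num.Theory.
Import numFieldNormedType.Exports.

Local Open Scope classical_set_scope.
Local Open Scope ring_scope.

Section SetFunction.
Context {R : realType} {N : nat}.
Implicit Types (f : {set 'I_N} -> R) (S T : {set 'I_N}).

(* The set is finite, and nonempty as soon as N >= 2, so the infimum is the
   minimum. *)
Definition min_distance f : R :=
  inf [set r | exists S i j, [/\ i \notin S, j \notin S, i != j &
    r = `|f (i |: S) + f (j |: S) - f S - f (i |: (j |: S))|]].

Record polymatroid_function f : Prop := PolymatroidFunction {
  pf_normalized : f finset.set0 = 0;
  pf_monotone : forall S T, S \subset T -> f S <= f T;
  pf_submodular : forall S T, f (S :|: T) + f (S :&: T) <= f S + f T;
  pf_total : f [set: 'I_N]%SET = 1;
  pf_distance_gt0 : 0 < min_distance f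
}.

Definition polymatroid f : set ('I_N -> R) :=
  [set x | (forall n, 0 <= x n) /\ (forall S, \sum_(n in S) x n <= f S)].

(* [Num.truncn] is the floor, as a natural number, on nonnegative reals. *)
Definition quantized f (M : nat) S : nat := Num.truncn (f S * M%:R).

Definition integral_polymatroid (g : {set 'I_N} -> nat) : set ('I_N -> nat) :=
  [set y | forall S, (\sum_(n in S) y n <= g S)%N].

End SetFunction.

(* The derivative relative to [0, 1]: one-sided at the two endpoints. *)
Definition has_derivative01 {R : realType} (u : R -> R) (x l : R) : Prop :=
  (u z - u x) / (z - x) @[z --> within `[0, 1] x^'] --> l.

Record admissible {R : realType} (alpha beta : R) (u : R -> R) : Prop :=
  Admissible {
  adm_ge0 : forall x, 0 <= x <= 1 -> 0 <= u x;
  adm_concave : convex_function (`[0, 1] : set R) (fun x => - u x);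
  adm_increasing : forall x y, 0 <= x -> x < y -> y <= 1 -> u x < u y;
  adm_derivative : forall x, 0 <= x <= 1 ->
    exists2 l, has_derivative01 u x l & beta < l < alpha
}.

Definition welfare {R : realType} {N : nat} (u : 'I_N -> R -> R)
  (x : 'I_N -> R) : R := \sum_n u n (x n).

Definition is_maximum_on {T : Type} {R : realType} (A : set T) (F : T -> R)
  (v : R) : Prop := (exists2 x, A x & F x = v) /\ forall x, A x -> F x <= v.

Section Mechanism.
Context {R : realType} {N : nat}.
Variables (f : {set 'I_N} -> R) (M : nat) (beta delta : R).

(* [w n m] is the m-th entry, 1 <= m <= quantized f M [set n], of the vector
   submitted by agent n; other values of m are never read. *)
Definition valid_bids (w : 'I_N -> nat -> int) : Prop :=
  forall n : 'I_N,
    (forall m, (1 <= m <= quantized f M [set n]%SET)%N -> 0 <= w n m) /\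
    (forall m, (1 <= m < quantized f M [set n]%SET)%N -> w n m.+1 <= w n m).

Definition reported_utility (w : nat -> int) (k : nat) : R :=
  \sum_(1 <= m < k.+1) (w m)%:~R * delta + beta * (k%:R / M%:R).

(* Any maximizer is an outcome: ties are broken arbitrarily. *)
Definition mechanism_outcome (w : 'I_N -> nat -> int) (y : 'I_N -> nat) :=
  [/\ valid_bids w,
      integral_polymatroid (quantized f M) y &
      forall z, integral_polymatroid (quantized f M) z ->
        \sum_n reported_utility (w n) (z n) <=
        \sum_n reported_utility (w n) (y n)].

Definition surrogate_marginal (u : R -> R) (m : nat) : R :=
  u (m%:R / M%:R) - u ((m%:R - 1) / M%:R) - beta / M%:R.

Inductive strategy := FLOOR | CEILING | CEILOOR.

Definition strategy_bid (s : strategy) (u : R -> R) (m : nat) : int :=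
  let v := surrogate_marginal u m / delta in
  match s with
  | FLOOR => Num.floor v
  | CEILING => Num.ceil v
  | CEILOOR => if (m <= M./2)%N then Num.ceil v else Num.floor v
  end.

End Mechanism.

Section StrategyBidsValid.
Context {R : realType}.
Variables (alpha beta : R) (u : R -> R).
Hypothesis hu : admissible alpha beta u.

Lemma admissible_concave (a b t : R) : 0 <= a <= 1 -> 0 <= b <= 1 ->
  0 <= t <= 1 -> t * u a + (1 - t) * u b <= u (t * a + (1 - t) * b).
Proof.
move=> ha hb /andP[t0 t1].
have := adm_concave hu (Itv01 t0 t1).
move=> /(_ a b); rewrite !inE /= !in_itv /= => /(_ ha hb).
rewrite !convRE /= /unstable.onem => h.
have : - u (t * a + (1 - t) * b) <= t * - u a + (1 - t) * - u b by exact: h.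
by lra.
Qed.

Lemma admissible_slope (a b : R) : 0 <= a -> a < b -> b <= 1 ->
  beta * (b - a) <= u b - u a.
Proof.
move=> a0 ab b1.
have hb : 0 <= b <= 1 by lra.
have [l hl /andP[bl _]] := adm_derivative hu hb.
have near_gt : \forall z \near within `[0, 1] b^',
    beta < (u z - u b) / (z - b) by exact: (cvgr_gt l hl).
move: near_gt; rewrite /within /dnbhs /= /nbhs /=.
move=> /nbhs_ballP [e /= e0 he].
pose d := Num.min (e / 2) (b - a).
have d0 : 0 < d by rewrite lt_min; apply/andP; split; lra.
have de : d < e by rewrite gt_min; apply/orP; left; lra.
have dba : d <= b - a by rewrite ge_min lexx orbT.
have bd : ball b e (b - d).
  by rewrite /ball /= opprB addrC subrK gtr0_norm.
have neq : b - d != b by apply/eqP; lra.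
have := he _ bd neq.
rewrite in_itv /= => /(_ _)/wrap[]; first lra.
have -> : b - d - b = - d by ring.
rewrite invrN mulrN -mulNr ltr_pdivlMr // => hs.
pose t := d / (b - a).
have ba0 : 0 < b - a by lra.
have tE : t * (b - a) = d by rewrite /t divfK // gt_eqF.
have t0 : 0 < t by rewrite divr_gt0.
have t1 : t <= 1 by rewrite ler_pdivrMr // mul1r.
have := @admissible_concave a b t.
have -> : t * a + (1 - t) * b = b - d by rewrite -tE; ring.
move=> /(_ _ _ _)/wrap[]; [lra|lra|lra|] => hc.
have : t * (u b - u a - beta * (b - a)) >= 0.
  by rewrite mulrBr mulrCA tE; lra.
by rewrite pmulr_rge0 // subr_ge0.
Qed.

Variables (M : nat).
Hypothesis M_gt0 : (0 < M)%N.

Lemma surrogate_marginal_ge0 m : (1 <= m <= M)%N ->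
  0 <= surrogate_marginal M beta u m.
Proof.
move=> /andP[m1 mM]; rewrite /surrogate_marginal.
have M0 : 0 < M%:R :> R by rewrite ltr0n.
have m1' : 1 <= m%:R :> R by rewrite ler1n.
have mM' : m%:R <= M%:R :> R by rewrite ler_nat.
have := @admissible_slope ((m%:R - 1) / M%:R) (m%:R / M%:R).
rewrite -mulrBl subKr mul1r ltr_pM2r ?invr_gt0 // ler_pdivrMr // mul1r.
rewrite mulr_ge0 ?invr_ge0 ?subr_ge0 ?(ltW M0) //.
by move=> /(_ isT _ mM')/wrap[]; lra.
Qed.

Lemma surrogate_marginal_noninc m : (1 <= m < M)%N ->
  surrogate_marginal M beta u m.+1 <= surrogate_marginal M beta u m.
Proof.
move=> /andP[m1 mM]; rewrite /surrogate_marginal.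
have M0 : 0 < M%:R :> R by rewrite ltr0n.
have m1' : 1 <= m%:R :> R by rewrite ler1n.
have mM' : m.+1%:R <= M%:R :> R by rewrite ler_nat.
have mSE : m.+1%:R = m%:R + 1 :> R by rewrite -natr1.
have := @admissible_concave ((m%:R - 1) / M%:R) (m.+1%:R / M%:R) (1 / 2).
have -> : 1 / 2 * ((m%:R - 1) / M%:R) + (1 - 1 / 2) * (m.+1%:R / M%:R)
    = m%:R / M%:R :> R by rewrite mSE; field; rewrite gt_eqF.
have -> : (m.+1%:R - 1) / M%:R = m%:R / M%:R :> R by rewrite mSE addrK.
rewrite !ler_pdivrMr // !ler_pdivlMr //.
move=> /(_ _ _ _)/wrap[]; [by lra|by lra|by lra|]; lra.
Qed.

End StrategyBidsValid.

(* Every strategy yields a legal message, so the validity requirement in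
   [mechanism_outcome] is no extra restriction. *)
Lemma strategy_bids_valid {R : realType} {N : nat} (f : {set 'I_N} -> R)
    (M : nat) (alpha beta delta : R) (u : 'I_N -> R -> R) (s : strategy) :
  polymatroid_function f -> (0 < M)%N -> 0 < delta ->
  (forall n, admissible alpha beta (u n)) ->
  valid_bids f M (fun n => strategy_bid M beta delta s (u n)).
Proof.
move=> hf M0 d0 hu n.
have qM : (quantized f M [set n]%SET <= M)%N.
  have fn1 : f [set n]%SET <= 1.
    by rewrite -(pf_total hf); apply: (pf_monotone hf); exact: finset.subsetT.
  have fn0 : 0 <= f [set n]%SET.
    by rewrite -(pf_normalized hf); apply: (pf_monotone hf); exact: finset.sub0set.
  rewrite -(ler_nat R); apply: le_trans (_ : f [set n]%SET * M%:R <= _).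
    by rewrite /quantized truncn_le // mulr_ge0.
  by rewrite ler_piMl.
split=> m /andP[m1 mq].
- have v0 : 0 <= surrogate_marginal M beta (u n) m / delta.
    rewrite divr_ge0 ?(ltW d0) //.
    by apply: (surrogate_marginal_ge0 (hu n) M0); rewrite m1 (leq_trans mq).
  have c0 : 0 <= Num.ceil (surrogate_marginal M beta (u n) m / delta).
    by rewrite -(ceil0 R) le_ceil.
  have fl0 : 0 <= Num.floor (surrogate_marginal M beta (u n) m / delta).
    by rewrite floor_ge0.
  by rewrite /strategy_bid; case: s => //; case: ifP.
- have vle : surrogate_marginal M beta (u n) m.+1 / delta <=
             surrogate_marginal M beta (u n) m / delta.
    rewrite ler_pM2r ?invr_gt0 //.
    by apply: (surrogate_marginal_noninc (hu n) M0); rewrite m1 (leq_trans mq).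
  rewrite /strategy_bid; case: s; [exact: le_floor|exact: le_ceil|].
  case: (leqP m.+1 M./2) => h1; case: (leqP m M./2) => h2.
  + exact: le_ceil.
  + by move: (ltn_trans h2 h1); rewrite ltnn.
  + apply: le_trans (le_floor vle) _; rewrite -(ler_int R).
    exact: le_trans (floor_le _) (ceil_ge _).
  + exact: le_floor.
Qed.

(* Main.v *)
(* The outcome y is compared with two integral bases obtained by rounding an
   optimal allocation x, which exists by compactness.

   First, welfare (y / M) >= welfare (z / M) - epsilon for every base z of the
   quantized polymatroid.  Symmetric exchange transforms z into y by moving one
   unit at a time; each move from agent i to agent j corresponds to a feasible
   reverse exchange at y, so the reported marginal of i at y is at most that of
   j, and by concavity the move loses at most the rounding error of the two
   bids.  This error is at most delta, with at most M moves, except under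
   CEILOOR when i already holds M / 2 units; it is then at most 2 * delta, but at
   most M / 2 units are misallocated.

   Secondly, subtract the linear function beta * t from the utilities, so that
   their slopes lie between 0 and gamma = alpha - beta, and let o be the reduced
   optimal welfare.  A base above the coordinatewise floor of M x has reduced
   welfare at least o - (N - 1) * gamma / M.  Iterating the minimum distance
   condition gives M * f S >= #|S| * (N - 1), so the coordinatewise ceiling of
   2 / (N + 1) * M x is feasible too; by concavity a base above it has reduced
   welfare at least 2 / (N + 1) * o.  The ratio follows from these two bounds:
   the first is used if M times the reduced welfare of y, plus M * epsilon, is
   at least 2 * gamma, and the second otherwise. *)

Require Import Defs.
From mathcomp Require Import all_boot all_order all_algebra.
From mathcomp Require Import all_classical all_reals all_analysis.
From mathcomp Require Import zify ring lra.
Set Implicit Arguments.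
Unset Strict Implicit.
Unset Printing Implicit Defensive.
Import Order.TTheory GRing.Theory Num.Theory.
Import numFieldNormedType.Exports.
Local Open Scope classical_set_scope.
Local Open Scope ring_scope.

(** * Exchange properties of integral polymatroids *)

(** Kept generic because it serves natural-number loads as well as real allocations. *)
Lemma big_setUI {R : Type} {idx : R} (op : Monoid.com_law idx) (I : finType)
    (S T : {set I}) (F : I -> R) :
  op (\big[op/idx]_(i in S :|: T) F i) (\big[op/idx]_(i in S :&: T) F i) =
  op (\big[op/idx]_(i in S) F i) (\big[op/idx]_(i in T) F i).
Proof.
rewrite (@big_setID _ _ op _ (S :|: T) T) (@big_setID _ _ op _ S T) /=.
rewrite finset.setIUl finset.setIid (finset.setUidPr (finset.subsetIr S T)).
rewrite finset.setDUl finset.setDv finset.setU0.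
by rewrite Monoid.mulmAC [RHS]Monoid.mulmAC; congr (op _ _); exact: Monoid.mulmC.
Qed.

Section IntegralPolymatroid.
Local Open Scope nat_scope.
Variables (N : nat) (g : {set 'I_N} -> nat).
Hypothesis g0 : g finset.set0 = 0.
Hypothesis g_submodular :
  forall S T, g (S :|: T) + g (S :&: T) <= g S + g T.
Implicit Types (y z : 'I_N -> nat) (S T : {set 'I_N}).

Definition load y S := \sum_(n in S) y n.

Lemma loadUI y S T : load y (S :|: T) + load y (S :&: T) = load y S + load y T.
Proof. exact: big_setUI. Qed.

Definition tight y S := load y S == g S.

Definition base y := integral_polymatroid g y /\ tight y [set: 'I_N]%SET.

Lemma load_le y S : integral_polymatroid g y -> load y S <= g S.
Proof. exact. Qed.

(** Uncrossing: the load is modular and [g] submodular, so the slacks at the union and at the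
    intersection, both nonnegative, add up to at most zero. *)
Lemma tightUI y S T : integral_polymatroid g y -> tight y S -> tight y T ->
  tight y (S :|: T) /\ tight y (S :&: T).
Proof.
move=> hy /eqP hS /eqP hT.
have := loadUI y S T; have := g_submodular S T.
have := load_le (S :|: T) hy; have := load_le (S :&: T) hy.
by split; apply/eqP; lia.
Qed.

Definition raise y (i : 'I_N) : 'I_N -> nat := fun n => y n + (n == i).

(** One unit passes from [j] to [i]. Adding before the truncated subtraction makes the case [i = j]
    the identity. *)
Definition exchange y (j i : 'I_N) : 'I_N -> nat :=
  fun n => y n + (n == i) - (n == j).

Lemma load_raise y i S : load (raise y i) S = load y S + (i \in S).
Proof.
rewrite /load big_split /=; congr (_ + _).
rewrite big_mkcond (bigD1 i) //= eqxx big1 ?addn0; first by case: ifP.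
by move=> n /negPf ->; case: ifP.
Qed.

Lemma load_exchange y i j S : 0 < y j ->
  load (exchange y j i) S + (j \in S) = load y S + (i \in S).
Proof.
move=> yj; rewrite -!load_raise; apply: eq_bigr => n _.
rewrite /raise /exchange subnK //.
by case: eqVneq => [->|] //; rewrite ltn_addr.
Qed.

Lemma raise_feasible y i : integral_polymatroid g y ->
  (forall S, i \in S -> ~~ tight y S) -> integral_polymatroid g (raise y i).
Proof.
move=> hy hi S; have := load_le S hy; have := hi S.
rewrite -/(load _ S) load_raise /tight.
by case: (i \in S) => [/(_ isT)|_]; rewrite /=; lia.
Qed.

Lemma exchange_feasible y i j : integral_polymatroid g y -> 0 < y j ->
  (forall S, i \in S -> j \notin S -> ~~ tight y S) ->
  integral_polymatroid g (exchange y j i).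
Proof.
move=> hy yj hij S; have := load_le S hy; have := hij S.
rewrite -/(load _ S); have := load_exchange i S yj; rewrite /tight.
case: (i \in S); case: (j \in S) => e; [move=> _|move/(_ isT isT)|move=> _..].
all: by move: e; rewrite /=; lia.
Qed.

(** The union of all tight sets is tight, hence proper; an agent outside it lies in no tight set. *)
Lemma raisable y : integral_polymatroid g y -> ~~ tight y [set: 'I_N]%SET ->
  exists i, integral_polymatroid g (raise y i).
Proof.
move=> hy hN; pose U := (\bigcup_(S | tight y S) S)%SET.
have hU : tight y U.
  apply: (big_ind (fun S => tight y S)) => //.
  - by rewrite /tight /load big_set0 g0.
  - by move=> S T hS hT; case: (tightUI hy hS hT).
have [i hi] : exists i, i \notin U.
  apply/existsP; apply: contraNT hN => /existsPn hi.
  suff <- : U = [set: 'I_N]%SET by [].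
  by apply/setP => n; rewrite finset.in_setT; apply/negPn/hi.
exists i; apply: raise_feasible => // S iS; apply: contra hi => hS.
by apply/finset.bigcupP; exists S.
Qed.

Lemma base_extension y : integral_polymatroid g y ->
  exists2 z, base z & forall n, y n <= z n.
Proof.
have [k] := ubnP (g [set: 'I_N]%SET - load y [set: 'I_N]%SET).
elim: k y => [//|k IH] y hk hy.
have [hN|/(raisable hy)[i hi]] := boolP (tight y [set: 'I_N]%SET).
  by exists y.
have [|z hz yz] := IH (raise y i) _ hi.
  have := load_le [set: 'I_N]%SET hi.
  by move: hk; rewrite load_raise finset.in_setT /=; lia.
by exists z => // n; apply: leq_trans (yz n); rewrite leq_addr.
Qed.

(** Symmetric exchange: a single [i] serves both bases. Let [S] be the least [z]-tight set
    containing [j] and [T] the greatest [y]-tight set avoiding [j]. Every [i] in [S :\: T] with a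
    unit to give can be exchanged with [j] in both bases. *)
Lemma base_exchange y z j : base y -> base z -> z j < y j ->
  exists i, [/\ y i < z i, base (exchange y j i) & base (exchange z i j)].
Proof.
move=> [hy yN] [hz zN] zyj.
pose S := (\bigcap_(A | tight z A && (j \in A)) A)%SET.
pose T := (\bigcup_(A | tight y A && (j \notin A)) A)%SET.
have /andP[hS jS] : tight z S && (j \in S).
  apply: (big_ind (fun A => tight z A && (j \in A))) => //.
  - by rewrite zN finset.in_setT.
  - move=> A B /andP[hA jA] /andP[hB jB].
    by have [_ ->] := tightUI hz hA hB; rewrite finset.in_setI jA.
have /andP[hT jT] : tight y T && (j \notin T).
  apply: (big_ind (fun A => tight y A && (j \notin A))) => //.
  - by rewrite /tight /load big_set0 g0 eqxx finset.in_set0.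
  - move=> A B /andP[hA jA] /andP[hB jB].
    by have [-> _] := tightUI hy hA hB; rewrite finset.in_setU negb_or jA.
have loadDI x A B : load x A = load x (A :&: B) + load x (A :\: B).
  exact: big_setID.
have [i iST yzi] : exists2 i, i \in S :\: T & y i < z i.
  (* Otherwise [z <= y] on [S :\: T], strictly at [j]; with [S] tight for [z] and [T] tight for [y],
     this contradicts submodularity at [S] and [T]. *)
  apply/exists_inP; apply: contraT => /exists_inPn h.
  have lt : load z (S :\: T) < load y (S :\: T).
    have jST : j \in S :\: T by rewrite finset.in_setD jT.
    rewrite /load (bigD1 j) // [X in _ < X](bigD1 j) //= -addSn leq_add //.
    by apply: leq_sum => n /andP[/h]; rewrite -leqNgt.
  move/eqP: hS; rewrite (loadDI z S T) => hS; move/eqP: hT => hT.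
  have := load_le (S :|: T) hy; have := load_le (S :&: T) hz.
  have := g_submodular S T; rewrite (loadDI y (S :|: T) T).
  rewrite finset.setIUl finset.setIid (finset.setUidPr (finset.subsetIr S T)).
  by rewrite finset.setDUl finset.setDv finset.setU0; lia.
move: iST; rewrite finset.in_setD => /andP[iT iS].
have yj : 0 < y j by apply: leq_ltn_trans zyj.
have zi : 0 < z i by apply: leq_ltn_trans yzi.
exists i; split=> //; split.
- apply: exchange_feasible => // A iA jA; apply: contra iT => hA.
  by apply/finset.bigcupP; exists A => //; rewrite hA.
- move: yN; have := load_exchange i [set: 'I_N]%SET yj.
  by rewrite /tight !finset.in_setT => /addIn ->.
- apply: exchange_feasible => // A jA iA; apply: contra iA => hA.
  by move/finset.bigcapP: iS; apply; rewrite hA.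
- move: zN; have := load_exchange j [set: 'I_N]%SET zi.
  by rewrite /tight !finset.in_setT => /addIn ->.
Qed.

End IntegralPolymatroid.

(** * Polymatroid set functions with positive minimum distance *)

Section SetFunction.
Context {R : realType} {N : nat} (f : {set 'I_N} -> R).
Hypothesis hf : polymatroid_function f.
Implicit Types S T A B : {set 'I_N}.
Local Notation Delta := (min_distance f).

Let submod S T : f (S :|: T) + f (S :&: T) <= f S + f T.
Proof. exact: pf_submodular. Qed.

Lemma polymatroid_function_ge0 S : 0 <= f S.
Proof.
by rewrite -(pf_normalized hf); apply: (pf_monotone hf); exact: finset.sub0set.
Qed.

Lemma polymatroid_function_le1 S : f S <= 1.
Proof.
by rewrite -(pf_total hf); apply: (pf_monotone hf); exact: finset.subsetT.
Qed.

Lemma min_distance_le S i j : i \notin S -> j \notin S -> i != j ->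
  Delta <= f (i |: S) + f (j |: S) - f S - f (i |: (j |: S)).
Proof.
move=> iS jS ij.
have E : 0 <= f (i |: S) + f (j |: S) - f S - f (i |: (j |: S)).
  have := submod (i |: S) (j |: S); rewrite finset.setUACA finset.setUid.
  have -> : (i |: S) :&: (j |: S) = S.
    apply/setP => n; rewrite !inE; case: eqVneq => [->|_] /=.
      by rewrite (negPf iS) (negPf ij).
    by case: (n \in S); rewrite ?orbT ?andbF.
  by rewrite -finset.setUA; lra.
rewrite -[leRHS]ger0_norm //; apply: ge_inf; last by exists S, i, j.
by exists 0 => _ [? [? [? [_ _ _ ->]]]].
Qed.

(** The distance condition at [A :&: B], for one element of each difference, is carried to [A] and
    [B] by two ordinary submodular inequalities, through [j |: A]. *)
Lemma strict_submodular A B : ~~ (A \subset B) -> ~~ (B \subset A) ->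
  Delta + f (A :|: B) + f (A :&: B) <= f A + f B.
Proof.
move=> /subsetPn[i iA iB] /subsetPn[j jB jA].
pose S := A :&: B.
have ij : i != j by apply: contraNneq iB => ->.
have iS : i \notin S by rewrite inE (negPf iB) andbF.
have jS : j \notin S by rewrite inE (negPf jA).
have h1 := min_distance_le iS jS ij.
have := submod A (i |: (j |: S)); have := submod (j |: A) B.
have -> : A :|: (i |: (j |: S)) = j |: A.
  by apply/setP => n; rewrite !inE; case: eqVneq => [->|_];
    rewrite ?iA ?orbT //=; case: (n == j); case: (n \in A).
have -> : A :&: (i |: (j |: S)) = i |: S.
  apply/setP => n; rewrite !inE; case: eqVneq => [->|_]; first by rewrite iA.
  by case: eqVneq => [->|_]; [rewrite (negPf jA)|case: (n \in A)].
have -> : (j |: A) :|: B = A :|: B.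
  by apply/setP => n; rewrite !inE; case: eqVneq => [->|_] //=; rewrite jB orbT.
have -> : (j |: A) :&: B = j |: S.
  by apply/setP => n; rewrite !inE; case: eqVneq => [->|_] //=; rewrite jB.
by rewrite -/S; lra.
Qed.

(** Each further agent joining [T] lowers the marginal of [n] by at least [Delta], and the last
    marginal is still nonnegative by monotonicity. *)
Lemma marginal_ge T n : n \notin T ->
  (N - #|T|).-1%:R * Delta <= f (n |: T) - f T.
Proof.
have [k] := ubnP (N - #|T|); elim: k T => // k IH T hk nT.
have card_nT : #|n |: T| = #|T|.+1 by rewrite cardsU1 nT.
have [/existsP[j]|/existsPn full] := boolP [exists j, j \notin n |: T].
  rewrite !inE negb_or => /andP[jn jT].
  have nj : n != j by rewrite eq_sym.
  have card_jT : #|j |: T| = #|T|.+1 by rewrite cardsU1 jT.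
  have njT : n \notin j |: T by rewrite !inE negb_or nj.
  have lt2 : (#|T| + 2 <= N)%N.
    have := max_card (mem (n |: (j |: T))).
    by rewrite cardsU1 njT card_jT card_ord; lia.
  have := IH (j |: T) _ njT; rewrite card_jT => /(_ _)/wrap[]; first lia.
  have := min_distance_le nT jT nj.
  have -> : (N - #|T|).-1 = (N - #|T|.+1).-1.+1 by lia.
  by rewrite -natr1 mulrDl mul1r; lra.
have nTT : n |: T = [set: 'I_N]%SET.
  by apply/setP => j; rewrite finset.in_setT; apply/negPn/full.
have cT : #|T|.+1 = N by rewrite -card_nT nTT cardsT card_ord.
have -> : (N - #|T|).-1 = 0%N by lia.
rewrite mul0r subr_ge0.
by apply: (pf_monotone hf); exact: finset.subsetUr.
Qed.

Lemma set_function_ge S : #|S|%:R * (N.-1)%:R * Delta <= 2 * f S.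
Proof.
have D0 := pf_distance_gt0 hf.
(* Building [S] agent by agent sums the marginal bounds [N - 1], [N - 2], and so on; the left side
   is exactly twice that sum, a form suited to induction. *)
suff : #|S|%:R * ((N - #|S|) + N.-1)%:R * Delta <= 2 * f S.
  apply: le_trans; rewrite ler_pM2r // -!natrM ler_nat leq_mul2l.
  by rewrite leq_addl orbT.
move: {2}#|S| (erefl #|S|) => k; elim: k S => [|k IH] S hS.
  by rewrite hS !mul0r mulr_ge0 ?polymatroid_function_ge0.
have [n nS] : exists n, n \in S by apply/set0Pn; rewrite -card_gt0 hS.
have nT : n \notin S :\ n by rewrite !inE eqxx.
have cT : #|S :\ n| = k by have := cardsD1 n S; rewrite nS hS => -[].
have := IH _ cT; have := marginal_ge nT; rewrite finset.setD1K // cT hS.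
have kN : (k < N)%N by rewrite -hS -[X in (_ <= X)%N]card_ord max_card.
have -> : (N - k).-1 = (N - k.+1)%N by lia.
move: D0; set D := Delta => D0 h1 h2.
have : k.+1%:R * ((N - k.+1) + N.-1)%:R * D =
       k%:R * ((N - k) + N.-1)%:R * D + 2 * ((N - k.+1)%:R * D).
  rewrite !mulrA -mulrDl; congr (_ * D).
  by rewrite -!natrM -natrD; congr (_%:R); nia.
by lra.
Qed.

Lemma polymatroid_le1 x n : polymatroid f x -> x n <= 1.
Proof.
move=> [_ /(_ [set n]%SET)]; rewrite big_set1 => h.
exact: le_trans h (polymatroid_function_le1 _).
Qed.

Lemma polymatroid_raisable x : polymatroid f x -> \sum_n x n != 1 ->
  exists i, exists2 e, 0 < e &
    polymatroid f (fun n => x n + (if n == i then e else 0)).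
Proof.
move=> [x0 xf] sx; pose tight S := \sum_(n in S) x n == f S.
pose U := (\bigcup_(S | tight S) S)%SET.
have hU : tight U.
  apply: (big_ind tight) => //.
  - by rewrite /tight big_set0 (pf_normalized hf).
  - move=> S T /eqP hS /eqP hT; apply/eqP.
    have h : \sum_(n in S :|: T) x n + \sum_(n in S :&: T) x n =
      \sum_(n in S) x n + \sum_(n in T) x n by exact: big_setUI.
    have h1 := xf (S :|: T); have h2 := xf (S :&: T); have h3 := submod S T.
    by apply/eqP; rewrite eq_le; apply/andP; split; lra.
have [i hi] : exists i, i \notin U.
  apply/existsP; apply: contraNT sx => /existsPn hi.
  have UT : U = [set: 'I_N]%SET.
    by apply/setP => n; rewrite finset.in_setT; apply/negPn/hi.
  move: hU; rewrite UT /tight (pf_total hf).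
  by under eq_bigl do rewrite finset.in_setT.
(* The least slack over the sets containing [i], all positive since [i] avoids every tight set; the
   seed [1] is just some positive number. *)
pose e := \big[Num.min/1]_(S : {set 'I_N} | i \in S)
  (f S - \sum_(n in S) x n).
exists i, e.
  apply: (big_ind (fun r => 0 < r)) => // [r r' r0 r0'|S iS].
    by rewrite lt_min r0.
  rewrite subr_gt0 lt_neqAle xf andbT; apply: contra hi => hS.
  by apply/finset.bigcupP; exists S.
have e0 : 0 <= e.
  apply: (big_ind (fun r => 0 <= r)) => // [r r' r0 r0'|S iS].
    by rewrite le_min r0.
  by rewrite subr_ge0 xf.
split=> [n|S]; first by case: ifP => _; rewrite addr_ge0.
rewrite big_split /=.
have [iS|iS] := boolP (i \in S).
  have : e <= f S - \sum_(n in S) x n by exact: bigmin_le_cond.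
  rewrite [X in _ + X <= _](bigD1 i iS) /= eqxx [X in e + X]big1 ?addr0.
    by lra.
  by move=> n /andP[_ /negPf ->].
rewrite [X in _ + X]big1 ?addr0 // => n nS.
by case: eqVneq => // ni; move: iS; rewrite -ni nS.
Qed.

(** * Quantization and rounding *)

Section Quantized.
Variable M : nat.
Hypothesis hM : 2 / Delta <= M%:R.

Lemma quantum_ge2 : 2 <= M%:R * Delta.
Proof. by rewrite -ler_pdivrMr // (pf_distance_gt0 hf). Qed.

Lemma quantum_gt0 : (0 < M)%N.
Proof. by case: M quantum_ge2 => // ; rewrite mul0r; lra. Qed.

Lemma quantized_ge m S : (m <= quantized f M S)%N = (m%:R <= f S * M%:R).
Proof. by rewrite truncn_ge_nat // mulr_ge0 ?polymatroid_function_ge0. Qed.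

Lemma quantized_set0 : quantized f M finset.set0 = 0%N.
Proof. by rewrite /quantized (pf_normalized hf) mul0r truncn0. Qed.

Lemma quantized_setT : quantized f M [set: 'I_N]%SET = M.
Proof. by rewrite /quantized (pf_total hf) mul1r natrK. Qed.

(** For incomparable sets, the two floors on the right lose less than 2 in total, and strict
    submodularity scaled by [M] supplies [M * Delta >= 2]. For comparable sets equality holds. *)
Lemma quantized_submodular S T :
  (quantized f M (S :|: T) + quantized f M (S :&: T) <=
   quantized f M S + quantized f M T)%N.
Proof.
have [ST|nST] := boolP (S \subset T).
  by rewrite (finset.setUidPr ST) (finset.setIidPl ST) addnC.
have [TS|nTS] := boolP (T \subset S).
  by rewrite (finset.setUidPl TS) (finset.setIidPr TS).
have M0 : 0 < M%:R :> R by rewrite ltr0n quantum_gt0.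
have bnd A : (quantized f M A)%:R <= f A * M%:R < (quantized f M A).+1%:R.
  by rewrite truncn_itv // mulr_ge0 ?polymatroid_function_ge0.
have [/andP[_ hS] /andP[_ hT]] := (bnd S, bnd T).
have [/andP[hU _] /andP[hI _]] := (bnd (S :|: T), bnd (S :&: T)).
have := strict_submodular nST nTS; rewrite -(ler_pM2r M0) !mulrDl.
have := quantum_ge2; rewrite mulrC => h1 h2.
by move: hS hT; rewrite -(ler_nat R) !natrD -!natr1; lra.
Qed.

Lemma quantized_base_sum y : base (quantized f M) y ->
  (\sum_n y n = M)%N.
Proof.
move=> [_ /eqP]; rewrite quantized_setT /load => <-.
by apply: eq_bigl => n; rewrite finset.in_setT.
Qed.

Lemma floor_feasible x : polymatroid f x ->
  integral_polymatroid (quantized f M) (fun n => Num.truncn (x n * M%:R)).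
Proof.
move=> [x0 xf] S; rewrite /= quantized_ge natr_sum.
apply: le_trans (_ : (\sum_(n in S) x n) * M%:R <= _); last first.
  by rewrite ler_wpM2r.
by rewrite mulr_suml ler_sum // => n _; rewrite truncn_le mulr_ge0.
Qed.

(* [truncn _ + 1] bounds the ceiling from above; the rounding error [#|S|] fits
   because [f S * M >= #|S| * (N - 1)] and [2 / (N + 1) + 1 / (N - 1) <= 1]. *)
Lemma scaled_ceil_feasible x : (2 < N)%N -> polymatroid f x ->
  integral_polymatroid (quantized f M)
    (fun n => (Num.truncn (2 / (N%:R + 1) * (x n * M%:R))).+1).
Proof.
move=> N2 [x0 xf] S; rewrite /= quantized_ge natr_sum.
set c := 2 / (N%:R + 1).
have N3 : 3 <= N%:R :> R by rewrite ler_nat.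
have c0 : 0 <= c by rewrite divr_ge0 //; lra.
have h : \sum_(n in S) (Num.truncn (c * (x n * M%:R))).+1%:R <=
         c * (f S * M%:R) + #|S|%:R :> R.
  apply: le_trans (_ : \sum_(n in S) (c * (x n * M%:R) + 1) <= _).
    apply: ler_sum => n _; rewrite -natr1 lerD2r truncn_le.
    by rewrite !mulr_ge0.
  rewrite big_split /= -mulr_sumr -mulr_suml sumr_const lerD2r.
  by rewrite ler_wpM2l // ler_wpM2r.
apply: le_trans h _.
have fM : 0 <= f S * M%:R by rewrite mulr_ge0 ?polymatroid_function_ge0.
have := set_function_ge S; have := quantum_ge2.
have -> : (N.-1)%:R = N%:R - 1 :> R by rewrite -subn1 natrB //; lia.
have s0 : 0 <= #|S|%:R :> R by [].
set s := (#|S|%:R : R) in s0 *; set D := Delta => h2 h3.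
have h4 : s * (N%:R - 1) <= f S * M%:R.
  have : s * (N%:R - 1) * D * M%:R <= 2 * f S * M%:R by rewrite ler_wpM2r.
  have : s * (N%:R - 1) * 2 <= s * (N%:R - 1) * (M%:R * D).
    by apply: ler_wpM2l => //; apply: mulr_ge0 => //; lra.
  by lra.
have N1 : 0 < N%:R + 1 :> R by lra.
set n := (N%:R : R) in N3 N1 h4 *; set F := f S * M%:R in h4 *.
have cF : c * F * (n + 1) = 2 * F by rewrite /c -/n; field; lra.
(* This uses [n >= 3]; with [h4] it yields [s * (n + 1) <= F * (n - 1)], which is the goal
   multiplied by [n + 1]. *)
have h5 : s * (n + 1) <= s * ((n - 1) * (n - 1)).
  by apply: ler_wpM2l => //; nra.
have h6 : s * (n - 1) * (n - 1) <= F * (n - 1) by apply: ler_wpM2r => //; lra.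
by rewrite -(ler_pM2r N1); lra.
Qed.

End Quantized.

End SetFunction.

(** * Existence of an optimal allocation *)

Section Admissible.
Context {R : realType} (alpha beta : R) (u : R -> R).
Hypothesis hu : admissible alpha beta u.

Lemma admissible_alpha_gt : beta < alpha.
Proof.
have [|l _ /andP[]] := adm_derivative hu (x := 0); first by lra.
exact: lt_trans.
Qed.

(** By concavity the chord from [a] to [b] is no steeper than a short chord starting at [a], whose
    slope is below [alpha] because the derivative at [a] is. *)
Lemma admissible_slope_le (a b : R) : 0 <= a -> a <= b -> b <= 1 ->
  u b - u a <= alpha * (b - a).
Proof.
move=> a0; rewrite le_eqVlt => /predU1P[-> _|ab b1].
  by rewrite !subrr mulr0.
have ha : 0 <= a <= 1 by lra.
have [l hl /andP[_ la]] := adm_derivative hu ha.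
have near_lt : \forall z \near within `[0, 1] a^',
    (u z - u a) / (z - a) < alpha by exact: (cvgr_lt l hl).
move: near_lt; rewrite /within /dnbhs /= /nbhs /=.
move=> /nbhs_ballP [e /= e0 he].
pose d := Num.min (e / 2) (b - a).
have d0 : 0 < d by rewrite lt_min; apply/andP; split; lra.
have de : d < e by rewrite gt_min; apply/orP; left; lra.
have dba : d <= b - a by rewrite ge_min lexx orbT.
have ball_ad : ball a e (a + d).
  by rewrite /ball /= opprD addNKr normrN gtr0_norm.
have neq : a + d != a by apply/eqP; lra.
have := he _ ball_ad neq.
rewrite in_itv /= => /(_ _)/wrap[]; first lra.
have -> : a + d - a = d by ring.
rewrite ltr_pdivrMr // => hs.
pose t := d / (b - a).
have ba0 : 0 < b - a by lra.
have tE : t * (b - a) = d by rewrite /t divfK // gt_eqF.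
have t0 : 0 < t by rewrite divr_gt0.
have t1 : t <= 1 by rewrite ler_pdivrMr // mul1r.
have := admissible_concave hu (a := b) (b := a) (t := t).
have -> : t * b + (1 - t) * a = a + d by rewrite -tE; ring.
move=> /(_ _ _ _)/wrap[]; [lra|lra|lra|] => hc.
have tA : t * (alpha * (b - a)) = alpha * d by rewrite -tE; ring.
by rewrite -(ler_pM2l t0) tA; lra.
Qed.

Lemma admissible_slope_ge (a b : R) : 0 <= a -> a <= b -> b <= 1 ->
  beta * (b - a) <= u b - u a.
Proof.
move=> a0; rewrite le_eqVlt => /predU1P[-> _|ab b1].
  by rewrite !subrr mulr0.
exact: (admissible_slope hu).
Qed.

Lemma surrogate_marginal_anti M m m' : (0 < M)%N -> (1 <= m)%N ->
  (m <= m')%N -> (m' <= M)%N ->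
  surrogate_marginal M beta u m' <= surrogate_marginal M beta u m.
Proof.
move=> M0 m1 /subnK <-; elim: (m' - m)%N => // k IH hk.
apply: le_trans (IH _); last by lia.
by rewrite addSn; apply: (surrogate_marginal_noninc hu) => //; lia.
Qed.

(** Utilities are controlled on the unit interval only; composing with this projection makes them
    continuous on the whole line. *)
Definition clip (x : R) : R := Num.max 0 (Num.min 1 x).

Lemma clip_in01 x : 0 <= clip x <= 1.
Proof.
by rewrite /clip le_max lexx /= ge_max ler01 ge_min lexx.
Qed.

Lemma clip_id x : 0 <= x <= 1 -> clip x = x.
Proof. by move=> /andP[x0 x1]; rewrite /clip min_r ?max_r. Qed.

Lemma clip_contract x y : x <= y -> 0 <= clip y - clip x <= y - x.
Proof.
move=> xy; have le01 : 0 <= 1 :> R by [].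
rewrite /clip; case: (leP 1 x) => ?; case: (leP 1 y) => ?;
  rewrite ?(max_r le01); case: (leP 0 x) => ?; case: (leP 0 y) => ?; lra.
Qed.

Lemma admissible_clip_continuous : 0 < beta -> continuous (u \o clip).
Proof.
move=> b0 x; apply/cvgrPdist_le => e e0 /=.
have a0 : 0 < alpha by apply: lt_trans admissible_alpha_gt.
(* The composite is [alpha]-Lipschitz. *)
have bnd p q : p <= q -> `|u (clip q) - u (clip p)| <= alpha * (q - p).
  move=> /clip_contract/andP[c0 c1].
  have /andP[p0 p1] := clip_in01 p; have /andP[q0 q1] := clip_in01 q.
  have lo := admissible_slope_ge p0 _ q1.
  have hi := admissible_slope_le p0 _ q1.
  rewrite subr_ge0 in c0; have := lo c0; have := hi c0 => hi' lo'.
  rewrite ger0_norm; last by apply: le_trans lo'; rewrite mulr_ge0 ?subr_ge0 // ltW.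
  by apply: le_trans hi' _; rewrite ler_pM2l.
near=> z.
have xz : `|x - z| <= e / alpha.
  by near: z; apply: cvgr_dist_le; [exact: cvg_id|rewrite divr_gt0].
apply: (le_trans (y := alpha * `|x - z|)); last first.
  by rewrite mulrC -ler_pdivlMr.
case: (leP z x) => h; first by rewrite [`|x - z|]ger0_norm ?subr_ge0 ?bnd.
rewrite distrC [`|x - z|]distrC [`|z - x|]ger0_norm ?subr_ge0 ?bnd ?(ltW h) //.
Unshelve. all: by end_near.
Qed.

End Admissible.

Lemma welfare_max {R : realType} {N : nat} (f : {set 'I_N} -> R)
    (alpha beta : R) (u : 'I_N -> R -> R) :
  polymatroid_function f -> 0 < beta ->
  (forall n, admissible alpha beta (u n)) ->
  exists2 x, polymatroid f x &
    forall z, polymatroid f z -> welfare u z <= welfare u x.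
Proof.
move=> hf b0 hu.
(* Allocations become row vectors, so that the polymatroid is a closed subset of a compact cube and
   the extreme value theorem applies. *)
pose A := [set v : 'rV[R]_N | polymatroid f (v ord0)].
pose F (v : 'rV[R]_N) := \sum_n (u n \o clip) (v ord0 n).
have coordC n : continuous (fun v : 'rV[R]_N => v ord0 n).
  exact: coord_continuous.
have sumC (P : pred 'I_N) (G : 'I_N -> 'rV[R]_N -> R) :
    (forall n, continuous (G n)) -> continuous (fun v => \sum_(n | P n) G n v).
  by move=> GC; apply: continuous_big => //; exact: add_continuous.
have FC : continuous F.
  apply: sumC => n v.
  apply: (continuous_comp (f := fun v : 'rV[R]_N => v ord0 n) (g := u n \o clip)).
    exact: coordC.
  exact: (admissible_clip_continuous (hu n)).
have AE : A = (\bigcap_n [set v | 0 <= v ord0 n]) `&`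
    \bigcap_(S in @setT {set 'I_N}) [set v | \sum_(n in S) v ord0 n <= f S].
  apply/seteqP; split=> v /= [h1 h2].
    by split=> [n _|S _]; [exact: h1|exact: h2].
  by split=> [n|S]; [exact: (h1 n)|exact: (h2 S)].
have Aclosed : closed A.
  rewrite AE; apply: closedI; apply: closed_bigI => i _.
  - apply: (preimage_closed (in1W _) (@closed_ge R 0)).
    exact: coordC.
  - apply: (preimage_closed (in1W _) (@closed_le R (f i))).
    by apply: sumC => n; exact: coordC.
have Acompact : compact A.
  apply: (subclosed_compact Aclosed
    (rV_compact (fun n => @segment_compact R 0 1))) => v Av n /=.
  rewrite in_itv /= (proj1 Av) /=.
  exact: (polymatroid_le1 hf _ Av).
have A0 : A !=set0.
  exists 0; split=> [n|S]; first by rewrite mxE.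
  rewrite big1 ?(polymatroid_function_ge0 hf) // => n _.
  by rewrite mxE.
have [v Av hv] := EVT_max_rV A0 Acompact (continuous_subspaceT FC).
have FE (w : 'rV[R]_N) : A w -> F w = welfare u (w ord0).
  move=> Aw; apply: eq_bigr => n _ /=; rewrite clip_id //.
  by rewrite (proj1 Aw) (polymatroid_le1 hf _ Aw).
exists (v ord0); first by rewrite inE in Av.
move=> z hz; pose w : 'rV[R]_N := \row_n z n.
have wz : w ord0 =1 z by move=> n; rewrite mxE.
have -> : z = w ord0 by apply/funext => n; rewrite wz.
have Aw : A w by rewrite /A /= (_ : w ord0 = z) //; apply/funext.
rewrite inE in Av; rewrite -!FE //; apply: hv; exact: mem_set.
Qed.

(** * Near-optimality of the mechanism among integral bases *)

Lemma sum_exchange {R : comPzRingType} {N : nat} (U : 'I_N -> nat -> R)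
    (y : 'I_N -> nat) (i j : 'I_N) : i != j -> (0 < y j)%N ->
  \sum_n U n (exchange y j i n) = \sum_n U n (y n) +
    (U i (y i).+1 - U i (y i)) - (U j (y j) - U j (y j).-1).
Proof.
move=> ij yj; have ji : j != i by rewrite eq_sym.
rewrite (bigD1 i) // [in RHS](bigD1 i) //= (bigD1 j) // [in RHS](bigD1 j) //=.
rewrite {1 2}/exchange !eqxx (negPf ij) (negPf ji) addn0 subn0 addn1 subn1.
rewrite (eq_bigr (fun n => U n (y n))); last first.
  by move=> n /andP[ni nj]; rewrite /exchange (negPf ni) (negPf nj) addn0 subn0.
by ring.
Qed.

(* Symmetric exchange moves [z] towards [y] one unit at a time, and by
   concavity each step costs at most the gap [K] measured at [y]. *)
Lemma exchange_gap {R : realDomainType} {N : nat} (g : {set 'I_N} -> nat)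
    (U : 'I_N -> nat -> R) (y z : 'I_N -> nat) (K : R) :
  g finset.set0 = 0%N ->
  (forall S T, g (S :|: T) + g (S :&: T) <= g S + g T)%N ->
  (forall n k l, (k <= l < g [set: 'I_N]%SET)%N ->
     U n l.+1 - U n l <= U n k.+1 - U n k) ->
  base g y -> base g z ->
  (forall i j, (y i < z i)%N -> (z j < y j)%N -> base g (exchange y j i) ->
     U i (y i).+1 - U i (y i) <= U j (y j) - U j (y j).-1 + K) ->
  \sum_n U n (z n) <= \sum_n U n (y n) + (\sum_n (y n - z n))%N%:R * K.
Proof.
move=> g0 gsub conc by_.
have le_total x n : base g x -> (x n <= g [set: 'I_N]%SET)%N.
  move=> [_ /eqP <-]; rewrite /load (bigD1 n) ?finset.in_setT //=.
  exact: leq_addr.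
have [k] := ubnP (\sum_n (y n - z n))%N; elim: k z => // k IH z hk bz gap.
have [/existsP[j zyj]|/existsPn yz] := boolP [exists j, z j < y j]%N; last first.
  have le_yz n : (y n <= z n)%N by rewrite leqNgt.
  have eq_yz n : z n = y n.
    have [[_ /eqP ty] [_ /eqP tz]] := (by_, bz).
    apply/eqP; rewrite eqn_leq le_yz andbT leqNgt; apply: contra_eqN tz => lt_yz.
    rewrite -ty gtn_eqF // /load (bigD1 n) ?finset.in_setT //=.
    rewrite [X in (_ < X)%N](bigD1 n) ?finset.in_setT //= -addSn leq_add //.
    exact: leq_sum.
  rewrite [X in X%:R]big1 => [|n _]; last by rewrite eq_yz subnn.
  by rewrite mul0r addr0 (eq_bigr (fun n => U n (y n))) // => n _; rewrite eq_yz.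
have [i [yzi byij bzij]] := base_exchange g0 gsub by_ bz zyj.
have ij : i != j by apply: contraTneq yzi => ->; rewrite -leqNgt ltnW.
have ji : j != i by rewrite eq_sym.
have zi : (0 < z i)%N by apply: leq_ltn_trans yzi.
have z'E n : exchange z i j n = (z n + (n == j) - (n == i))%N by [].
have z'i : exchange z i j i = (z i).-1.
  by rewrite z'E eqxx (negPf ij) addn0 subn1.
have z'j : exchange z i j j = (z j).+1.
  by rewrite z'E eqxx (negPf ji) addn1 subn0.
have z'n n : n != i -> n != j -> exchange z i j n = z n.
  by move=> ni nj; rewrite z'E (negPf ni) (negPf nj) addn0 subn0.
have dist : (\sum_n (y n - z n) = (\sum_n (y n - exchange z i j n)).+1)%N.
  rewrite (bigD1 j) //= [in RHS](bigD1 j) //= z'j.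
  rewrite -addSn (_ : y j - z j = (y j - (z j).+1).+1)%N; last by lia.
  congr (_ + _)%N; apply: eq_bigr => n nj.
  have [->|ni] := eqVneq n i; last by rewrite z'n.
  by rewrite z'i; lia.
(* The new base lies coordinatewise between [z] and [y], so every pair admissible for it was already
   admissible for [z]. *)
rewrite dist in hk *; have /(IH _ hk bzij) : forall i' j',
    (y i' < exchange z i j i')%N -> (exchange z i j j' < y j')%N ->
    base g (exchange y j' i') ->
    U i' (y i').+1 - U i' (y i') <= U j' (y j') - U j' (y j').-1 + K.
  move=> i' j' hi hj; apply: gap.
    have [E|ni'] := eqVneq i' i; first by rewrite E.
    have [E|nj'] := eqVneq i' j; first by move: hi; rewrite E z'j; lia.
    by move: hi; rewrite z'n.
  have [E|ni'] := eqVneq j' i; first by move: hj; rewrite E z'i; lia.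
  have [E|nj'] := eqVneq j' j; first by rewrite E.
  by move: hj; rewrite z'n.
have := gap i j yzi zyj byij.
rewrite sum_exchange // -natr1 mulrDl mul1r.
(* Concavity moves the marginals from [z] to [y]: the unit lost by [i] is worth at most the next
   unit of [i] at [y], and the unit gained by [j] at least the last unit of [j] at [y]. *)
have zS : (z i).-1.+1 = z i by rewrite prednK.
have yS : (y j).-1.+1 = y j by rewrite prednK //; lia.
have := conc i (y i) (z i).-1; rewrite zS => /(_ _)/wrap[].
  by have := le_total z i bz; lia.
have := conc j (z j) (y j).-1; rewrite yS => /(_ _)/wrap[].
  by have := le_total y j by_; lia.
by lra.
Qed.

Section Mechanism.
Context {R : realType} {N : nat} (f : {set 'I_N} -> R) (M : nat).
Hypothesis hf : polymatroid_function f.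
Hypothesis hM : 2 / min_distance f <= M%:R.
Variables (beta delta : R).
Hypothesis beta_gt0 : 0 < beta.
Hypothesis delta_gt0 : 0 < delta.

Let M_gt0 : (0 < M)%N. Proof. exact: (quantum_gt0 hf hM). Qed.

Lemma reported_utilityS (w : nat -> int) k :
  reported_utility M beta delta w k.+1 - reported_utility M beta delta w k =
  (w k.+1)%:~R * delta + beta / M%:R.
Proof.
rewrite /reported_utility big_nat_recr //= -natr1.
by rewrite mulrDl mul1r mulrDr; ring.
Qed.

(** An outcome that is not a base could be raised, gaining a nonnegative bid plus [beta / M > 0]. *)
Lemma mechanism_outcome_base w y : mechanism_outcome f M beta delta w y ->
  base (quantized f M) y.
Proof.
move=> [hw hy ymax]; split=> //; apply: contraT => /(raisable _ _ hy)[||i hi].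
- exact: quantized_set0.
- exact: quantized_submodular.
have := ymax _ hi; rewrite (bigD1 i) // [leRHS](bigD1 i) //=.
rewrite (eq_bigr (fun n => reported_utility M beta delta (w n) (y n))); last first.
  by move=> n ni; rewrite /raise (negPf ni) addn0.
rewrite lerD2r -subr_le0 /raise eqxx addn1 reported_utilityS leNgt.
rewrite ltr_wpDl ?divr_gt0 ?ltr0n // mulr_ge0 ?(ltW delta_gt0) // ler0z.
(* Feasibility on the singleton keeps the index [(y i).+1] within the submitted vector. *)
apply: (hw i).1; have := hi [set i]%SET; rewrite big_set1 /raise eqxx addn1.
by move=> ->.
Qed.

Lemma mechanism_outcome_bid_le w y (i j : 'I_N) :
  mechanism_outcome f M beta delta w y -> i != j -> (0 < y j)%N ->
  integral_polymatroid (quantized f M) (exchange y j i) ->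
  w i (y i).+1 <= w j (y j).
Proof.
move=> [_ _ ymax] ij yj /ymax.
rewrite (sum_exchange (fun n => reported_utility M beta delta (w n))) //.
rewrite reported_utilityS -[y j in X in _ - (X - _)]prednK // reported_utilityS.
rewrite prednK // -addrA gerDl subr_le0 lerD2r ler_pM2r //.
by rewrite ler_int.
Qed.

(** A two-sided bound valid for either rounding; the sharper one-sided bounds enter only where the
    direction of rounding is known. *)
Lemma strategy_bid_near s (v : R -> R) m :
  let V := surrogate_marginal M beta v m in
  let b := (strategy_bid M beta delta s v m)%:~R * delta in
  V <= b + delta /\ b <= V + delta.
Proof.
move=> V b; pose q := V / delta.
have VE : V = q * delta by rewrite /q divfK ?gt_eqF.
suff : q <= (strategy_bid M beta delta s v m)%:~R + 1 /\
       (strategy_bid M beta delta s v m)%:~R <= q + 1.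
  have addE x : x * delta + delta = (x + 1) * delta by rewrite mulrDl mul1r.
  by rewrite VE /b !addE !ler_pM2r.
have fl : q <= (Num.floor q)%:~R + 1 /\ (Num.floor q)%:~R <= q + 1.
  have := floorD1_gt q; have := floor_le q; rewrite intrD; split; lra.
have ce : q <= (Num.ceil q)%:~R + 1 /\ (Num.ceil q)%:~R <= q + 1.
  have := ceil_ge q; have := ceilB1_lt q; rewrite intrB; split; lra.
by move=> {b}; case: s => //=; case: ifP.
Qed.

Variables (alpha : R) (s : strategy) (u : 'I_N -> R -> R).
Hypothesis hu : forall n, admissible alpha beta (u n).
Hypothesis hs : s = CEILOOR -> ~~ odd M.
Variable y : 'I_N -> nat.
Let w n := strategy_bid M beta delta s (u n).
Hypothesis hy : mechanism_outcome f M beta delta w y.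

(** A floor at [j] or a ceiling at [i] errs in the favourable direction, leaving one error of
    [delta]. Under [CEILOOR] the entry [(y i).+1] is a ceiling as long as [y i < M./2]. *)
Lemma outcome_marginal_gap (i j : 'I_N) : i != j -> (0 < y j)%N -> 
  integral_polymatroid (quantized f M) (exchange y j i) ->
  surrogate_marginal M beta (u i) (y i).+1 <=
    surrogate_marginal M beta (u j) (y j) +
      (if s is CEILOOR then if (y i < M./2)%N then 1 else 2 else 1) * delta.
Proof.
move=> ij yj hij; have := mechanism_outcome_bid_le hy ij yj hij.
rewrite -(ler_int R) -(ler_pM2r delta_gt0).
have [+ _] := strategy_bid_near s (u i) (y i).+1.
have [_ +] := strategy_bid_near s (u j) (y j).
rewrite /w; case: s => /=.
- have := floor_le (surrogate_marginal M beta (u j) (y j) / delta).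
  rewrite ler_pdivlMr // => hj _ hi hw.
  by rewrite mul1r (le_trans hi) // lerD2r (le_trans hw).
- have := ceil_ge (surrogate_marginal M beta (u i) (y i).+1 / delta).
  by rewrite ler_pdivrMr // => hi hj _ hw; rewrite mul1r (le_trans hi) // (le_trans hw).
case: (ltnP (y i) M./2) => _.
  have := ceil_ge (surrogate_marginal M beta (u i) (y i).+1 / delta).
  by rewrite ler_pdivrMr // => hi hj _ hw; rewrite mul1r (le_trans hi) // (le_trans hw).
move=> hj hi hw; rewrite (_ : 2 * delta = delta + delta); last by ring.
by rewrite addrA (le_trans hi) // lerD2r (le_trans hw).
Qed.

(* A gap of [2 * delta] needs an agent with at least half of the units, and
   then at most half of the units are misallocated. *)
Lemma outcome_near_optimal z : base (quantized f M) z ->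
  welfare u (fun n => (z n)%:R / M%:R) <=
  welfare u (fun n => (y n)%:R / M%:R) + M%:R * delta.
Proof.
move=> bz; have by_ := mechanism_outcome_base hy.
have sy := quantized_base_sum hf by_.
pose U n k := u n (k%:R / M%:R).
have US n k : U n k.+1 - U n k = surrogate_marginal M beta (u n) k.+1 + beta / M%:R.
  by rewrite /U /surrogate_marginal -natr1 addrK; ring.
pose K : R := if [exists i, (y i < z i) && (M./2 <= y i)]%N
  then (if s is CEILOOR then 2 else 1) * delta else delta.
have gap i j : (y i < z i)%N -> (z j < y j)%N ->
    base (quantized f M) (exchange y j i) ->
    U i (y i).+1 - U i (y i) <= U j (y j) - U j (y j).-1 + K.
  move=> yzi zyj [hij _].
  have ij : i != j by apply: contraTneq yzi => ->; rewrite -leqNgt ltnW.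
  have yj : (0 < y j)%N by apply: leq_ltn_trans zyj.
  have := outcome_marginal_gap ij yj hij.
  have := US j (y j).-1; rewrite prednK // => ->; rewrite US /K => h.
  rewrite [leRHS]addrAC lerD2r; case: ifPn => [_|/existsPn few];
    apply: le_trans h _; rewrite lerD2l.
    by rewrite ler_pM2r //; case: s => //; case: ifP => // _; lra.
  by have := few i; rewrite yzi -ltnNge => ->; case: s; rewrite mul1r.
have conc n k l : (k <= l < quantized f M [set: 'I_N]%SET)%N ->
    U n l.+1 - U n l <= U n k.+1 - U n k.
  rewrite (quantized_setT hf) => /andP[kl lM]; rewrite !US lerD2r.
  exact: (surrogate_marginal_anti (hu n)).
apply: le_trans (exchange_gap (quantized_set0 hf M)
  (quantized_submodular hf hM) conc by_ bz gap) _.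
rewrite lerD2l /K.
have leM : (\sum_n (y n - z n) <= M)%N.
  by rewrite -[leqRHS]sy leq_sum // => n _; rewrite leq_subr.
case: ifP => [/existsP[i /andP[yzi hi]]|_]; last first.
  by rewrite ler_pM2r // ler_nat.
rewrite mulrA ler_pM2r //; have := hs.
case: s => [_|_|/(_ erefl) evenM]; rewrite ?mulr1 ?ler_nat // -natrM ler_nat.
(* Agent [i] has no excess over [z], so all excess units belong to the other agents, who hold
   [M - y i] units, at most half of [M]. *)
have : (\sum_n (y n - z n) <= M - y i)%N.
  rewrite -sy (bigD1 i) //= [in leqRHS](bigD1 i) //= addKn.
  rewrite (_ : y i - z i = 0)%N ?add0n; last by lia.
  by rewrite leq_sum // => n _; rewrite leq_subr.
by have := odd_double_half M; rewrite (negPf evenM); lia.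
Qed.

End Mechanism.

(** * Rounding the optimal allocation *)

Lemma ratio_bound (R : realFieldType) (M N alpha beta epsilon opt W : R) :
  0 < M -> 3 <= N -> 0 < beta <= alpha -> 0 < epsilon <= beta / 2 ->
  beta <= opt -> M * (opt - epsilon - W) <= (N - 1) * (alpha - beta) ->
  2 * (opt - beta) <= (N + 1) * (W + epsilon - beta) ->
  (M * beta + 2 * (alpha - beta) - M * epsilon) /
    (M * alpha + 2 * (alpha - beta) - (M - N + 1) * (alpha - beta)) <= W / opt.
Proof.
move=> M0 N3 /andP[b0 ba] /andP[e0 eb] hopt hadd hmul.
pose gamma := alpha - beta; have g0 : 0 <= gamma by rewrite subr_ge0.
pose w := M * (W + epsilon - beta); pose o := M * (opt - beta).
pose c := M * (beta - epsilon); pose e := M * epsilon.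
have ce : e <= c by rewrite ler_pM2l //; lra.
have e_ge0 : 0 <= e by rewrite mulr_ge0 // ltW.
have h1 : 0 <= (N - 1) * gamma + w - o by rewrite /w /o /gamma; lra.
have h2 : 0 <= (N + 1) * w - 2 * o.
  have : 0 <= M * ((N + 1) * (W + epsilon - beta) - 2 * (opt - beta)).
    by rewrite mulr_ge0 ?subr_ge0 // ltW.
  by rewrite /w /o; lra.
(* The denominator equals [M * beta + (N + 1) * gamma]. *)
have Ng : 0 <= (N + 1) * gamma by rewrite mulr_ge0 //; lra.
have Mb : 0 < M * beta by rewrite mulr_gt0.
have opt0 : 0 < opt by lra.
rewrite ler_pdivrMr; last by rewrite /gamma in Ng; lra.
rewrite mulrAC ler_pdivlMr // -(ler_pM2l M0) -subr_ge0.
(* After cross-multiplication the difference is a combination of the two hypotheses and of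
   [w - 2 * gamma], the only term of unknown sign. *)
have -> : M * (W * (M * alpha + 2 * (alpha - beta) - (M - N + 1) * (alpha - beta)))
  - M * ((M * beta + 2 * (alpha - beta) - M * epsilon) * opt) =
  c * ((N - 1) * gamma + w - o) + e * (w - 2 * gamma)
  + gamma * ((N + 1) * w - 2 * o).
  by rewrite /c /e /w /o /gamma; ring.
have c_ge0 : 0 <= c := le_trans e_ge0 ce.
apply: addr_ge0; last exact: mulr_ge0.
have [hw|/ltW hw] := leP (2 * gamma) w.
  by apply: addr_ge0; apply: mulr_ge0; rewrite // subr_ge0.
(* Here [w - 2 * gamma] is nonpositive, so its coefficient [e] may be increased to [c]; [h2] then
   bounds the bracket below by half of [(N - 3) * (2 * gamma - w)]. *)
apply: le_trans (_ : c * (((N - 1) * gamma + w - o) + (w - 2 * gamma)) <= _).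
  apply: mulr_ge0 => //.
  have : 0 <= (N - 3) * (2 * gamma - w) by rewrite mulr_ge0 ?subr_ge0.
  by lra.
by rewrite mulrDr lerD2l ler_wnM2r // subr_le0.
Qed.

Section Rounding.
Context {R : realType} {N : nat} (f : {set 'I_N} -> R) (M : nat).
Hypothesis hf : polymatroid_function f.
Hypothesis hM : 2 / min_distance f <= M%:R.
Variables (alpha beta : R) (u : 'I_N -> R -> R).
Hypothesis hu : forall n, admissible alpha beta (u n).
Variable x : 'I_N -> R.
Hypothesis hx : polymatroid f x.
Hypothesis sx : \sum_n x n = 1.

Let M_gt0 : 0 < M%:R :> R. Proof. by rewrite ltr0n (quantum_gt0 hf hM). Qed.

Let x01 n : 0 <= x n <= 1.
Proof. by rewrite (proj1 hx) (polymatroid_le1 hf _ hx). Qed.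

Let base01 z : base (quantized f M) z ->
  (forall n, 0 <= ((z n)%:R / M%:R : R) <= 1) /\
  \sum_n (z n)%:R / M%:R = 1 :> R.
Proof.
move=> bz; have sz := quantized_base_sum hf bz; split=> [n|]; last first.
  by rewrite -mulr_suml -natr_sum sz divff ?gt_eqF.
rewrite divr_ge0 ?(ltW M_gt0) //= ler_pdivrMr // mul1r ler_nat -[leqRHS]sz.
by rewrite (bigD1 n) //= leq_addr.
Qed.

(** Passing from [x] down to its floor costs slope at most [alpha], and going up to the base regains
    slope at least [beta]. Since [x] and the base have equal totals, only [alpha - beta] times the
    sum of the fractional parts remains. *)
Lemma floor_rounding_gap : (0 < N)%N ->
  exists2 z, base (quantized f M) z &
    M%:R * (welfare u x - welfare u (fun n => (z n)%:R / M%:R)) <=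
    (N%:R - 1) * (alpha - beta).
Proof.
move=> N0; pose k n := Num.truncn (x n * M%:R).
have hk : integral_polymatroid (quantized f M) k := floor_feasible hf M hx.
have [z bz kz] := base_extension (quantized_set0 hf M)
  (quantized_submodular hf hM) hk.
exists z => //; have [z01 sz] := base01 bz.
have kx n : (k n)%:R <= x n * M%:R < (k n).+1%:R.
  by rewrite truncn_itv // mulr_ge0 ?(proj1 hx) ?ltW.
have gap n : M%:R * (u n (x n) - u n ((z n)%:R / M%:R)) <=
    beta * (x n * M%:R - (z n)%:R) + (alpha - beta) * (x n * M%:R - (k n)%:R).
  have /andP[k1 _] := kx n; have /andP[x0 x1] := x01 n.
  have /andP[z0 z1] := z01 n.
  have kM : 0 <= (k n)%:R / M%:R :> R by rewrite divr_ge0 ?(ltW M_gt0).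
  have h1 : u n (x n) - u n ((k n)%:R / M%:R) <=
      alpha * (x n - (k n)%:R / M%:R).
    by apply: (admissible_slope_le (hu n)); rewrite // ler_pdivrMr.
  have h2 : beta * ((z n)%:R / M%:R - (k n)%:R / M%:R) <=
      u n ((z n)%:R / M%:R) - u n ((k n)%:R / M%:R).
    apply: (admissible_slope_ge (hu n)) => //.
    by rewrite ler_pM2r ?invr_gt0 // ler_nat.
  have := lerB h1 h2; rewrite -(ler_pM2l M_gt0) => h.
  apply: le_trans (le_trans _ h) _; first by rewrite ler_pM2l //; lra.
  by rewrite le_eqVlt; apply/orP; left; apply/eqP; field; rewrite gt_eqF.
rewrite /welfare -sumrB mulr_sumr; apply: le_trans (ler_sum _ (fun n _ => gap n)) _.
have sxM : \sum_n x n * M%:R = M%:R by rewrite -mulr_suml sx mul1r.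
have szM : \sum_n (z n)%:R = M%:R :> R.
  by rewrite -natr_sum (quantized_base_sum hf bz).
rewrite big_split /= -!mulr_sumr !sumrB sxM szM subrr mulr0 add0r mulrC.
rewrite ler_wpM2r ?subr_ge0 ?(ltW (admissible_alpha_gt (hu (Ordinal N0)))) //.
(* The fractional parts sum to an integer strictly below [N], hence at most [N - 1]. *)
have : M%:R < \sum_n (k n)%:R + N%:R :> R.
  rewrite -sxM.
  have -> : \sum_n (k n)%:R + N%:R = \sum_(n < N) ((k n).+1)%:R :> R.
    under [RHS]eq_bigr do rewrite -natr1.
    by rewrite big_split /= sumr_const card_ord.
  apply: ltr_sum; last by move=> n _; have /andP[] := kx n.
  by apply/hasP; exists (Ordinal N0); rewrite ?mem_index_enum.
by rewrite -natr_sum -natrD ltr_nat -(ler_nat R) natrD -natr1 natr_sum; lra.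
Qed.

Lemma scaled_rounding_gap : (2 < N)%N ->
  exists2 z, base (quantized f M) z &
    2 * (welfare u x - beta) <=
    (N%:R + 1) * (welfare u (fun n => (z n)%:R / M%:R) - beta).
Proof.
move=> N2; set c := 2 / (N%:R + 1) : R.
have N3 : 3 <= N%:R :> R by rewrite ler_nat.
have N1 : 0 < N%:R + 1 :> R by lra.
have c0 : 0 <= c by rewrite divr_ge0 // ltW.
have c1 : c <= 1 by rewrite ler_pdivrMr // mul1r; lra.
have [z bz kz] := base_extension (quantized_set0 hf M)
  (quantized_submodular hf hM) (scaled_ceil_feasible hf hM N2 hx).
exists z => //; have [z01 sz] := base01 bz.
(* The reduced utility is nondecreasing, concave and nonnegative at 0, so beyond [c * x n] it keeps
   at least the fraction [c] of its value at [x n]. *)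
have gap n : c * (u n (x n) - beta * x n) <=
    u n ((z n)%:R / M%:R) - beta * ((z n)%:R / M%:R).
  have /andP[x0 x1] := x01 n; have /andP[z0 z1] := z01 n.
  have cx : c * x n <= (z n)%:R / M%:R.
    rewrite ler_pdivlMr // -mulrA; apply/ltW/(lt_le_trans (truncnS_gt _)).
    by rewrite ler_nat; exact: kz.
  have cx0 : 0 <= c * x n by rewrite mulr_ge0.
  have h1 := admissible_slope_ge (hu n) cx0 cx z1.
  have := admissible_concave (hu n) (a := x n) (b := 0) (t := c).
  rewrite mulr0 addr0 c0 c1 x0 x1 lexx ler01 => /(_ isT isT isT) h2.
  have : 0 <= (1 - c) * u n 0.
    rewrite mulr_ge0 ?subr_ge0 //; apply: (adm_ge0 (hu n)).
    by rewrite lexx ler01.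
  by lra.
have : c * (welfare u x - beta) <= welfare u (fun n => (z n)%:R / M%:R) - beta.
  have := ler_sum _ (fun n (_ : true) => gap n) => /(_ (index_enum 'I_N)).
  by rewrite -mulr_sumr !sumrB -!mulr_sumr sx sz mulr1.
by rewrite -(ler_pM2l N1) mulrA /c mulrCA divff ?mulr1 ?gt_eqF.
Qed.

End Rounding.

(** From [N * (N - 1) * Delta <= 2 <= M * Delta]. It makes the positive part in the final ratio
    equal to [M - N + 1]. *)
Lemma agents_le_quanta {R : realType} {N : nat} (f : {set 'I_N} -> R) (M : nat) :
  polymatroid_function f -> 2 / min_distance f <= M%:R -> (2 < N)%N ->
  (N <= M)%N.
Proof.
move=> hf hM N2; have := set_function_ge hf [set: 'I_N]%SET.
rewrite cardsT card_ord (pf_total hf) mulr1 => h.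
have := le_trans h (quantum_ge2 hf hM).
rewrite ler_pM2r ?(pf_distance_gt0 hf) // -natrM ler_nat.
by apply: leq_trans; rewrite leq_pmulr //; lia.
Qed.

Lemma welfare_max_total {R : realType} {N : nat} (f : {set 'I_N} -> R)
    (alpha beta : R) (u : 'I_N -> R -> R) (x : 'I_N -> R) :
  polymatroid_function f -> (forall n, admissible alpha beta (u n)) ->
  polymatroid f x ->
  (forall z, polymatroid f z -> welfare u z <= welfare u x) ->
  \sum_n x n = 1.
Proof.
move=> hf hu hx xmax; apply/eqP; apply: contraT.
move=> /(polymatroid_raisable hf hx)[i [e e0 hxe]].
have := xmax _ hxe; rewrite leNgt => /negP[]; rewrite /welfare.
rewrite (bigD1 i) //= [ltRHS](bigD1 i) //= eqxx.
rewrite [in ltRHS](eq_bigr (fun n => u n (x n))); last first.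
  by move=> n /negPf ->; rewrite addr0.
rewrite ltrD2r; apply: (adm_increasing (hu i)); rewrite ?(proj1 hx) ?ltrDl //.
by have := polymatroid_le1 hf i hxe; rewrite eqxx.
Qed.

Theorem theorem4p7 (R : realType) (N : nat) (hN : (3 < N)%N)
  (f : {set 'I_N} -> R) (hf : polymatroid_function f)
  (M : nat) (hM : 2 / min_distance f <= M%:R)
  (alpha beta : R) (halpha : 0 < alpha) (hbeta : 0 < beta)
  (epsilon : R) (heps : 0 < epsilon <= beta / 2)
  (delta : R) (hdelta : delta = epsilon / M%:R)
  (s : strategy) (hs : s = CEILOOR -> ~~ odd M)
  (u : 'I_N -> R -> R) (hu : forall n, admissible alpha beta (u n))
  (y : 'I_N -> nat)
  (hy : mechanism_outcome f M beta delta
          (fun n => strategy_bid M beta delta s (u n)) y) :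
  exists2 opt : R, is_maximum_on (polymatroid f) (welfare u) opt &
    (M%:R * beta + 2 * (alpha - beta) - M%:R * epsilon) /
    (M%:R * alpha + 2 * (alpha - beta)
       - Num.max (M%:R - N%:R + 1) 0 * (alpha - beta))
    <= welfare u (fun n => (y n)%:R / M%:R) / opt.
Proof.
have M0 : 0 < M%:R :> R by rewrite ltr0n (quantum_gt0 hf hM).
have delta0 : 0 < delta.
  by rewrite hdelta divr_gt0 //; case/andP: heps.
have Mdelta : M%:R * delta = epsilon by rewrite hdelta mulrC divfK ?gt_eqF.
have N0 : (0 < N)%N by lia.
have N2 : (2 < N)%N by lia.
have [x hx xmax] := welfare_max hf hbeta hu.
have sx := welfare_max_total hf hu hx xmax.
exists (welfare u x); first by split=> //; exists x.
have NM : N%:R <= M%:R :> R by rewrite ler_nat (agents_le_quanta hf hM).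
rewrite max_l; last by lra.
have near z : base (quantized f M) z ->
    welfare u (fun n => (z n)%:R / M%:R) <=
    welfare u (fun n => (y n)%:R / M%:R) + epsilon.
  by rewrite -Mdelta; exact: (outcome_near_optimal hf hM hbeta delta0 hu hs hy).
apply: ratio_bound => //.
- by rewrite ler_nat.
- by rewrite hbeta ltW // (admissible_alpha_gt (hu (Ordinal N0))).
(* The optimum is at least [beta], since [u n (x n) >= beta * x n] and the shares sum to 1. *)
- rewrite -[leLHS]mulr1 -sx mulr_sumr; apply: ler_sum => n _.
  have x0 : 0 <= x n := proj1 hx n.
  have := admissible_slope_ge (hu n) (lexx 0) x0 (polymatroid_le1 hf n hx).
  have : 0 <= u n 0 by apply: (adm_ge0 (hu n)); rewrite lexx ler01.
  by rewrite subr0; lra.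
- have [z /near hz hgap] := floor_rounding_gap hf hM hu hx sx N0.
  by apply: le_trans hgap; rewrite ler_pM2l //; lra.
have [z /near hz hgap] := scaled_rounding_gap hf hM hu hx sx N2.
by apply: le_trans hgap _; rewrite ler_wpM2l // lerD2r.
Qed.
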